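(* For every compact Hausdorff space $K$, the set of all operators $T\in\mathscr{B}(C(K))$ satisfying condition (B) forms a closed left ideal of the Banach algebra $\mathscr{B}(C(K))$.
   Context: Banach spaces are over either the real or the complex scalars. $C(K)$ is the Banach space of all scalar-valued continuous functions on $K$ with the supremum norm, and $\mathscr{B}(C(K))$ is the Banach algebra of all bounded linear operators on $C(K)$ with the operator norm. The support $\mathrm{supp}(f)$ of $f\in C(K)$ is the closure of $\{x\in K\colon f(x)\neq 0\}$. For $f,g\in C(K)$ write $f\prec g$ if $f\neq g$ and $f(x)=g(x)$ for every $x\in\mathrm{supp}(f)$; this is a strict (partial) ordering on $C(K)$. A $\prec$-chain is a subset of $C(K)$ any two distinct elements of which are comparable under $\prec$. Condition (B) for a bounded linear operator $T$ from $C(K)$ into a Banach space: for each uncountable $\prec$-chain $F$ in $C(K)$ with $\sup_{f\in F}\|f\|<\infty$ one has $\inf\{\|Tf-Tg\|\colon f,g\in F,\ f\neq g\}=0$. *)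

(* Defs.v *)
From HB Require Import structures.
From mathcomp Require Import all_boot all_order all_algebra.
From mathcomp Require Import complex.
From mathcomp Require Import mathcomp_extra boolp classical_sets functions.
From mathcomp Require Import cardinality reals topology normedtype.

Set Implicit Arguments.
Unset Strict Implicit.
Unset Printing Implicit Defensive.

Import Order.TTheory GRing.Theory Num.Theory.
Import numFieldNormedType.Exports.

Local Open Scope classical_set_scope.
Local Open Scope ring_scope.

(* Norms in a [normedModType F] take their values in [F] itself, also when
   [F] is the field of complex numbers, where [x <= y] means that [y - x] is a
   nonnegative real.  The operator norm is a supremum in [F]; the following
   interface provides the completeness that its existence requires. *)
HB.mixin Record NumField_hasNnegSup F of Num.NumField F := {
  nneg_supremums : forall A : set F, A !=set0 -> (forall x, A x -> 0 <= x) ->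
    has_ubound A -> supremums A !=set0
}.

#[short(type="scalarFieldType")]
HB.structure Definition ScalarField :=
  {F of NumField_hasNnegSup F & Num.NumField F}.

Lemma real_nneg_supremums (R : realType) (A : set R) :
  A !=set0 -> (forall x, A x -> 0 <= x) -> has_ubound A ->
  supremums A !=set0.
Proof.
move=> A0 _ ubA; exists (sup A); split.
- by move=> x Ax; apply: sup_upper_bound.
- by move=> y Ay; apply: ge_sup.
Qed.

#[non_forgetful_inheritance]
HB.instance Definition _ (R : realType) :=
  NumField_hasNnegSup.Build R (@real_nneg_supremums R).

Lemma complex_nneg_supremums (R : realType) (A : set R[i]) :
  A !=set0 -> (forall x, A x -> 0 <= x) -> has_ubound A ->
  supremums A !=set0.
Proof.
move=> [a Aa] A0 [u uA]; set B := [set complex.Re x | x in A].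
have supB : has_sup B.
  split; first by exists (complex.Re a), a.
  exists (complex.Re u) => _ [x Ax <-].
  by have := uA _ Ax; rewrite lecE => /andP[].
exists (real_complex R (sup B)); split.
- move=> x Ax; have := A0 _ Ax; rewrite !lecE/= => /andP[/eqP-> _].
  by rewrite eqxx/=; apply: sup_upper_bound => //; exists x.
- move=> y yA; have := yA _ Aa; have := A0 _ Aa.
  rewrite !lecE/= => /andP[/eqP-> _] /andP[/eqP-> _]; rewrite eqxx/=.
  apply: ge_sup; first by exists (complex.Re a), a.
  by move=> _ [x Ax <-]; have := yA _ Ax; rewrite lecE => /andP[].
Qed.

#[non_forgetful_inheritance]
HB.instance Definition _ (R : realType) :=
  NumField_hasNnegSup.Build R[i] (@complex_nneg_supremums R).

HB.mixin Record isCompactHausdorff K of Topological K := {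
  compactT : compact [set: K];
  hausdorffT : hausdorff_space K
}.

#[short(type="compactHausdorffType")]
HB.structure Definition CompactHausdorff :=
  {K of isCompactHausdorff K & Topological K}.

(* The library's topologies on [continuousType] are not normed; this alias
   carries the supremum norm. *)
Definition Cspace (K : compactHausdorffType) (F : numFieldType) : Type :=
  continuousType K F.

Section Cspace_lmodule.
Context {K : compactHausdorffType} {F : numFieldType}.
Implicit Types f g h : Cspace K F.

HB.instance Definition _ := gen_eqMixin (Cspace K F).
HB.instance Definition _ := gen_choiceMixin (Cspace K F).

Lemma Cspace_ext f g : (forall x, f x = g x) -> f = g.
Proof. by move=> fg; apply/continuousEP. Qed.

Lemma Cspace_continuous f : continuous f.
Proof. exact: (@cts_fun _ _ f). Qed.

Lemma cts_add f g : continuous (fun x => f x + g x).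
Proof. by move=> x; apply: cvgD; exact: Cspace_continuous. Qed.

Lemma cts_opp f : continuous (fun x => - f x).
Proof. by move=> x; apply: cvgN; exact: Cspace_continuous. Qed.

Lemma cts_scale (a : F) f : continuous (fun x => a * f x).
Proof. by move=> x; apply: cvgMl_tmp; exact: Cspace_continuous. Qed.

Definition Cspace_zero : Cspace K F := cst (0 : F).
Definition Cspace_add f g : Cspace K F := mkcts (@cts_add f g).
Definition Cspace_opp f : Cspace K F := mkcts (@cts_opp f).
Definition Cspace_scale (a : F) f : Cspace K F := mkcts (@cts_scale a f).

Lemma Cspace_addA : associative Cspace_add.
Proof. by move=> f g h; apply: Cspace_ext => x; exact: addrA. Qed.
Lemma Cspace_addC : commutative Cspace_add.
Proof. by move=> f g; apply: Cspace_ext => x; exact: addrC. Qed.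
Lemma Cspace_add0 : left_id Cspace_zero Cspace_add.
Proof. by move=> f; apply: Cspace_ext => x; exact: add0r. Qed.
Lemma Cspace_addN : left_inverse Cspace_zero Cspace_opp Cspace_add.
Proof. by move=> f; apply: Cspace_ext => x; exact: addNr. Qed.

HB.instance Definition _ := GRing.isZmodule.Build (Cspace K F)
  Cspace_addA Cspace_addC Cspace_add0 Cspace_addN.

Lemma Cspace_scaleA a b f :
  Cspace_scale a (Cspace_scale b f) = Cspace_scale (a * b) f.
Proof. by apply: Cspace_ext => x; exact: mulrA. Qed.
Lemma Cspace_scale1 : left_id 1 Cspace_scale.
Proof. by move=> f; apply: Cspace_ext => x; exact: mul1r. Qed.
Lemma Cspace_scaleDr : right_distributive Cspace_scale +%R.
Proof. by move=> a f g; apply: Cspace_ext => x; exact: mulrDr. Qed.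
Lemma Cspace_scaleDl f : {morph Cspace_scale^~ f : a b / a + b}.
Proof. by move=> a b; apply: Cspace_ext => x; exact: mulrDl. Qed.

HB.instance Definition _ := GRing.Zmodule_isLmodule.Build F (Cspace K F)
  Cspace_scaleA Cspace_scale1 Cspace_scaleDr Cspace_scaleDl.

Lemma Cspace0E x : (0 : Cspace K F) x = 0. Proof. by []. Qed.
Lemma CspaceDE f g x : (f + g) x = f x + g x. Proof. by []. Qed.
Lemma CspaceNE f x : (- f) x = - f x. Proof. by []. Qed.
Lemma CspaceBE f g x : (f - g) x = f x - g x. Proof. by []. Qed.
Lemma CspaceZE (a : F) f x : (a *: f) x = a * f x. Proof. by []. Qed.

End Cspace_lmodule.

Lemma supremumE (F : numFieldType) (x0 s : F) (A : set F) :
  A !=set0 -> supremums A s -> supremum x0 A = s.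
Proof.
move=> /set0P /negPf A0 sA; rewrite /supremum A0.
case: xgetP => [y _ yA|/(_ s)//].
by apply: (@is_subset1_supremums _ _ A).
Qed.

Section Cspace_norm.
Context {K : compactHausdorffType} {F : numFieldType}.
Implicit Types f g : Cspace K F.

(* The default value 0 is only used when [K] is empty. *)
Definition sup_norm f : F := supremum 0 (range (fun x => `|f x|)).

Lemma norm_attained f (x1 : K) : exists x0, forall x, `|f x| <= `|f x0|.
Proof.
apply: contrapT => nomax.
have lt_ex x0 : exists x, `|f x0| < `|f x|.
  apply: contrapT => nx; apply: nomax; exists x0 => x.
  by rewrite real_leNgt ?normr_real//; apply/negP => ?; apply: nx; exists x.
pose T : set_system K := [set S | exists a, forall b, `|f a| <= `|f b| -> S b].
have TF : Filter T.
  split; first by exists x1.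
  - move=> P Q [a aP] [b bQ].
    have [ab|ba] := real_leP (normr_real (f a)) (normr_real (f b)).
    + exists b => c bc; split; first by apply: aP; exact: le_trans bc.
      exact: bQ.
    + exists a => c ac; split; first exact: aP.
      by apply: bQ; exact: le_trans (ltW ba) ac.
  - by move=> P Q PQ [a aP]; exists a => b /aP/PQ.
have /compact_near_coveringP/(_ K T (fun i x => `|f x| < `|f i|) TF) := @compactT K.
case=> [x _|a /(_ a (lexx _) a I)]; last by rewrite ltxx.
have [y xy] := lt_ex x.
exists ([set x' | `|f x'| < `|f y|], [set i | `|f y| <= `|f i|]); last first.
  by move=> [x' i]/= [] /lt_le_trans h /h.
split; last by exists y.
exact: (@cvgr_norm_lt F F^o K (nbhs x) _ f _ (@Cspace_continuous _ _ f x)).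
Qed.

Lemma sup_normP f : 0 <= sup_norm f /\
  ((forall x, `|f x| <= sup_norm f) /\
   (forall c, 0 <= c -> (forall x, `|f x| <= c) -> sup_norm f <= c)).
Proof.
have [[x1 _]|K0] := pselect ([set: K] !=set0); last first.
  have nK (x : K) : False by apply: K0; exists x.
  have R0 : range (fun x => `|f x|) = set0.
    by rewrite -subset0 => y [x]; case: (nK x).
  by rewrite /sup_norm R0 supremum0; split => //; split => // x; case: (nK x).
have [x0 x0max] := norm_attained f x1.
have -> : sup_norm f = `|f x0|.
  apply: supremumE; first by exists `|f x0|, x0.
  split; first by move=> _ [x _ <-].
  by move=> y; apply; exists x0.
by split=> //; split.
Qed.

Lemma ler_sup_normD f g : sup_norm (f + g) <= sup_norm f + sup_norm g.
Proof.
have [f0 [fle _]] := sup_normP f; have [g0 [gle _]] := sup_normP g.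
have [_ [_ ]] := sup_normP (f + g); apply; first exact: addr_ge0.
by move=> x; rewrite CspaceDE (le_trans (ler_normD _ _))// lerD.
Qed.

Lemma sup_normZ (a : F) f : sup_norm (a *: f) = `|a| * sup_norm f.
Proof.
have le_ (b : F) h : sup_norm (b *: h) <= `|b| * sup_norm h.
  have [h0 [hle _]] := sup_normP h; have [_ [_]] := sup_normP (b *: h).
  apply; first exact: mulr_ge0.
  by move=> x; rewrite CspaceZE normrM ler_wpM2l.
apply/eqP; rewrite eq_le le_/=.
have [->|a0] := eqVneq a 0; first by rewrite normr0 mul0r; case: (sup_normP (0 *: f)).
have := le_ a^-1 (a *: f).
by rewrite scalerA mulVf// scale1r normfV ler_pdivlMl ?normr_gt0.
Qed.

Lemma sup_norm_eq0 f : sup_norm f = 0 -> f = 0.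
Proof.
have [_ [fle _]] := sup_normP f => f0.
by apply: Cspace_ext => x; apply/normr0_eq0/le_anti; rewrite -{1}f0 fle/=.
Qed.

HB.instance Definition _ := Lmodule_isNormed.Build F (Cspace K F)
  ler_sup_normD sup_normZ sup_norm_eq0.

End Cspace_norm.

Section ConditionB.
Context {K : compactHausdorffType} {F : numFieldType}.
Implicit Types f g : Cspace K F.

Definition supp f : set K := closure [set x | f x != 0].

Definition prec f g := f <> g /\ (forall x, supp f x -> f x = g x).

Definition prec_chain (A : set (Cspace K F)) :=
  forall f g, A f -> A g -> f <> g -> prec f g \/ prec g f.

(* [infimums A 0] says that 0 is the infimum of [A] and, unlike
   [infimum _ A = 0], involves no default value. *)
Definition condition_B (Y : normedModType F) (T : Cspace K F -> Y) :=
  forall A : set (Cspace K F),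
    prec_chain A -> ~ countable A -> has_ubound [set `|f| | f in A] ->
    infimums [set r : F | exists f g, [/\ A f, A g, f <> g & r = `|T f - T g|]] 0.

End ConditionB.

Record bounded_op (F : scalarFieldType) (E : normedModType F) := BoundedOp {
  bounded_op_fun :> E -> E;
  bounded_op_linear : linear bounded_op_fun;
  bounded_op_bounded : bounded_near bounded_op_fun (nbhs (0 : E))
}.

HB.instance Definition _ (F : scalarFieldType) (E : normedModType F)
    (T : bounded_op E) :=
  GRing.isLinear.Build F E E *:%R T (bounded_op_linear T).

Section bounded_op_algebra.
Context {F : scalarFieldType} {E : normedModType F}.
Local Notation B := (bounded_op E).
Implicit Types (S T U : B) (u v : E) (a b : F).

HB.instance Definition _ := gen_eqMixin B.
HB.instance Definition _ := gen_choiceMixin B.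

Lemma bounded_op_ext S T : (forall u, S u = T u) -> S = T.
Proof.
case: S T => [S Sl Sb] [T Tl Tb]/= /funext ST.
by rewrite ST in Sl Sb *; congr BoundedOp; exact: Prop_irrelevance.
Qed.

Lemma bounded_op_le T : exists2 c, 0 <= c & forall u, `|T u| <= c * `|u|.
Proof.
have /linear_boundedP/pinfty_ex_gt0[c c0 Tc] := bounded_op_bounded T.
by exists c => //; exact: ltW.
Qed.

Lemma zero_linear : linear (fun _ : E => 0 : E).
Proof. by move=> a u v; rewrite scaler0 addr0. Qed.
Lemma add_linear S T : linear (fun u => S u + T u).
Proof. by move=> a u v; rewrite !linearP scalerDr addrACA. Qed.
Lemma opp_linear T : linear (fun u => - T u).
Proof. by move=> a u v; rewrite linearP opprD scalerN. Qed.
Lemma scale_linear a T : linear (fun u => a *: T u).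
Proof. by move=> b u v; rewrite linearP scalerDr !scalerA mulrC. Qed.
Lemma id_linear : linear (fun u : E => u).
Proof. by []. Qed.
Lemma comp_linear S T : linear (fun u => S (T u)).
Proof. by move=> a u v; rewrite !linearP. Qed.

Lemma le_bounded (f : E -> E) c : 0 <= c ->
  (forall u, `|f u| <= c * `|u|) -> bounded_near f (nbhs (0 : E)).
Proof.
move=> c0 fc; apply/ex_bound; exists c; apply/nbhs_norm0P; exists 1 => //= u /=.
by move=> /ltW u1; rewrite (le_trans (fc u))// ler_piMr.
Qed.

Lemma zero_bounded : bounded_near (fun _ : E => 0 : E) (nbhs (0 : E)).
Proof. by apply: (@le_bounded _ 0) => // u; rewrite normr0 mul0r. Qed.
Lemma add_bounded S T : bounded_near (fun u => S u + T u) (nbhs (0 : E)).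
Proof.
have [c c0 Sc] := bounded_op_le S; have [d d0 Td] := bounded_op_le T.
apply: (@le_bounded _ (c + d)) => [|u]; first exact: addr_ge0.
by rewrite (le_trans (ler_normD _ _))// mulrDl lerD.
Qed.
Lemma opp_bounded T : bounded_near (fun u => - T u) (nbhs (0 : E)).
Proof.
have [c c0 Tc] := bounded_op_le T.
by apply: (@le_bounded _ c) => // u; rewrite normrN.
Qed.
Lemma scale_bounded a T : bounded_near (fun u => a *: T u) (nbhs (0 : E)).
Proof.
have [c c0 Tc] := bounded_op_le T.
apply: (@le_bounded _ (`|a| * c)) => [|u]; first exact: mulr_ge0.
by rewrite normrZ -mulrA ler_wpM2l.
Qed.
Lemma id_bounded : bounded_near (fun u : E => u) (nbhs (0 : E)).
Proof. by apply: (@le_bounded _ 1) => // u; rewrite mul1r. Qed.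
Lemma comp_bounded S T : bounded_near (fun u => S (T u)) (nbhs (0 : E)).
Proof.
have [c c0 Sc] := bounded_op_le S; have [d d0 Td] := bounded_op_le T.
apply: (@le_bounded _ (c * d)) => [|u]; first exact: mulr_ge0.
by rewrite (le_trans (Sc _))// -mulrA ler_wpM2l.
Qed.

Definition op_zero : B := BoundedOp zero_linear zero_bounded.
Definition op_add S T : B := BoundedOp (@add_linear S T) (@add_bounded S T).
Definition op_opp T : B := BoundedOp (@opp_linear T) (@opp_bounded T).
Definition op_scale a T : B :=
  BoundedOp (@scale_linear a T) (@scale_bounded a T).
Definition op_id : B := BoundedOp id_linear id_bounded.
Definition op_comp S T : B := BoundedOp (@comp_linear S T) (@comp_bounded S T).

Lemma op_addA : associative op_add.
Proof. by move=> S T U; apply: bounded_op_ext => u; exact: addrA. Qed.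
Lemma op_addC : commutative op_add.
Proof. by move=> S T; apply: bounded_op_ext => u; exact: addrC. Qed.
Lemma op_add0 : left_id op_zero op_add.
Proof. by move=> T; apply: bounded_op_ext => u; exact: add0r. Qed.
Lemma op_addN : left_inverse op_zero op_opp op_add.
Proof. by move=> T; apply: bounded_op_ext => u; exact: addNr. Qed.

HB.instance Definition _ := GRing.isZmodule.Build B
  op_addA op_addC op_add0 op_addN.

Lemma op_compA : associative op_comp.
Proof. by move=> S T U; apply: bounded_op_ext. Qed.
Lemma op_comp1l : left_id op_id op_comp.
Proof. by move=> T; apply: bounded_op_ext. Qed.
Lemma op_comp1r : right_id op_id op_comp.
Proof. by move=> T; apply: bounded_op_ext. Qed.
Lemma op_compDl : left_distributive op_comp +%R.
Proof. by move=> S T U; apply: bounded_op_ext. Qed.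
Lemma op_compDr : right_distributive op_comp +%R.
Proof. by move=> S T U; apply: bounded_op_ext => u; exact: linearD. Qed.

HB.instance Definition _ := GRing.Zmodule_isPzRing.Build B
  op_compA op_comp1l op_comp1r op_compDl op_compDr.

Lemma op_scaleA a b T : op_scale a (op_scale b T) = op_scale (a * b) T.
Proof. by apply: bounded_op_ext => u; exact: scalerA. Qed.
Lemma op_scale1 : left_id 1 op_scale.
Proof. by move=> T; apply: bounded_op_ext => u; exact: scale1r. Qed.
Lemma op_scaleDr : right_distributive op_scale +%R.
Proof. by move=> a S T; apply: bounded_op_ext => u; exact: scalerDr. Qed.
Lemma op_scaleDl T : {morph op_scale^~ T : a b / a + b}.
Proof. by move=> a b; apply: bounded_op_ext => u; exact: scalerDl. Qed.

HB.instance Definition _ := GRing.Zmodule_isLmodule.Build F B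
  op_scaleA op_scale1 op_scaleDr op_scaleDl.

Lemma op0E u : (0 : B) u = 0. Proof. by []. Qed.
Lemma op1E u : (1 : B) u = u. Proof. by []. Qed.
Lemma opDE S T u : (S + T) u = S u + T u. Proof. by []. Qed.
Lemma opNE T u : (- T) u = - T u. Proof. by []. Qed.
Lemma opBE S T u : (S - T) u = S u - T u. Proof. by []. Qed.
Lemma opZE a T u : (a *: T) u = a *: T u. Proof. by []. Qed.
Lemma opME S T u : (S * T) u = S (T u). Proof. by []. Qed.

Definition op_norm T : F :=
  supremum 0 [set `|T u| | u in [set u : E | `|u| <= 1]].

Lemma op_normP T : 0 <= op_norm T /\
  ((forall u, `|T u| <= op_norm T * `|u|) /\
   (forall c, 0 <= c -> (forall u, `|T u| <= c * `|u|) -> op_norm T <= c)).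
Proof.
set A := [set `|T u| | u in [set u : E | `|u| <= 1]].
have A0 : A 0 by exists 0; rewrite /= ?linear0 normr0.
have [c c0 Tc] := bounded_op_le T.
have [||s sA] := @nneg_supremums F A (ex_intro _ _ A0).
- by move=> _ [u _ <-].
- exists c => _ [u u1 <-].
  by rewrite (le_trans (Tc u))// ler_piMr.
have Ts : op_norm T = s by apply: supremumE => //; exists 0.
case: sA => Au lA; rewrite Ts; split; first exact: Au.
split=> [u|d d0 Td].
  have [->|u0] := eqVneq u 0; first by rewrite linear0 !normr0 mulr0.
  have n0 : 0 < `|u| by rewrite normr_gt0.
  rewrite -ler_pdivrMr//; apply: Au; exists (`|u|^-1 *: u) => /=.
    by rewrite normrZ normfV normr_id mulVf ?gt_eqF.
  by rewrite linearZ/= normrZ normfV normr_id mulrC.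
by apply: lA => _ [u u1 <-]; rewrite (le_trans (Td u))// ler_piMr.
Qed.

Lemma ler_op_normD S T : op_norm (S + T) <= op_norm S + op_norm T.
Proof.
have [S0 [Sle _]] := op_normP S; have [T0 [Tle _]] := op_normP T.
have [_ [_]] := op_normP (S + T); apply; first exact: addr_ge0.
by move=> u; rewrite opDE (le_trans (ler_normD _ _))// mulrDl lerD.
Qed.

Lemma op_normZ a T : op_norm (a *: T) = `|a| * op_norm T.
Proof.
have le_ b U : op_norm (b *: U) <= `|b| * op_norm U.
  have [U0 [Ule _]] := op_normP U; have [_ [_]] := op_normP (b *: U).
  apply; first exact: mulr_ge0.
  by move=> u; rewrite opZE normrZ -mulrA ler_wpM2l.
apply/eqP; rewrite eq_le le_/=.
have [->|a0] := eqVneq a 0.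
  by rewrite normr0 mul0r; case: (op_normP (0 *: T)).
have := le_ a^-1 (a *: T).
by rewrite scalerA mulVf// scale1r normfV ler_pdivlMl ?normr_gt0.
Qed.

Lemma op_norm_eq0 T : op_norm T = 0 -> T = 0.
Proof.
have [_ [Tle _]] := op_normP T => T0.
apply: bounded_op_ext => u; apply/normr0_eq0/le_anti.
by rewrite (le_trans (Tle u)) ?T0 ?mul0r/=.
Qed.

HB.instance Definition _ := Lmodule_isNormed.Build F B
  ler_op_normD op_normZ op_norm_eq0.

Lemma op_normM S T : `|S * T| <= `|S| * `|T|.
Proof.
have [S0 [Sle _]] := op_normP S; have [T0 [Tle _]] := op_normP T.
have [_ [_]] := op_normP (S * T); apply; first exact: mulr_ge0.
by move=> u; rewrite opME (le_trans (Sle _))// -mulrA ler_wpM2l.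
Qed.

(* An ideal of an algebra is in particular a linear subspace. *)
Definition left_ideal (I : set B) :=
  [/\ I 0,
      forall S T, I S -> I T -> I (S + T),
      forall a T, I T -> I (a *: T) &
      forall S T, I T -> I (S * T)].

Definition closed_left_ideal (I : set B) := closed I /\ left_ideal I.

End bounded_op_algebra.

(* Main.v *)
Require Import Defs.
From mathcomp Require Import all_boot all_order all_algebra.
From mathcomp Require Import complex.
From mathcomp Require Import mathcomp_extra boolp classical_sets functions.
From mathcomp Require Import cardinality reals topology normedtype.
Import numFieldNormedType.Exports.
Local Open Scope classical_set_scope.
Local Open Scope ring_scope.

(** The only clause that is not a direct estimate is stability under sums.
    An uncountable bounded chain [A] and an operator [S] satisfying (B) make
    [A] a space for the pseudometric [`|S f - S g|].  Every subset of [A] is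
    again a bounded chain, so (B) says that no [e]-separated subset of [A] is
    uncountable: the image of [A] under [S] is separable.  Hence [A] is covered
    by countably many balls of radius [e] around a maximal [e]-separated set,
    and one of these balls contains uncountably many points of [A]
    ([uncountable_small_subset]).  That ball is again an uncountable bounded
    chain, on which [S] oscillates by less than [2 * e]; applying (B) for a
    second operator [T] to it gives distinct [f] and [g] for which
    [`|S f - S g|] and [`|T f - T g|] are small at once
    ([condition_B_add]).

    Left multiplication and scaling enlarge the differences [`|T f - T g|] at
    most by a constant factor ([condition_B_dominated]).  Closedness holds
    because the chains in (B) are bounded, so that operators close in norm are
    uniformly close on a given chain ([condition_B_limit]). *)

Import Order.TTheory GRing.Theory Num.Theory.

Lemma uncountable_sub_distinct {X : Type} {A : set X} :
  ~ countable A ->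
  exists x y, [/\ A x, A y & x <> y].
Proof.
move=> nA; apply: contrapT => ndist; apply: nA.
have [[x Ax]|A0] := pselect (A !=set0); last first.
  suff -> : A = set0 by exact: countable0.
  by apply/not_notP => /eqP /set0P.
suff -> : A = [set x] by exact: countable1.
apply/seteqP; split=> [y Ay|_ ->//].
by apply: contrapT => yx; apply: ndist; exists y, x.
Qed.

(** A pseudometric space without uncountable [e]-separated sets is covered by
    countably many [e]-balls, and an uncountable set cannot meet each of them
    in a countable set. *)
Lemma uncountable_small_subset (F : numFieldType) (Y : normedModType F)
    (X : Type) (T : X -> Y) (A : set X) (e : F) :
  0 < e -> ~ countable A ->
  (forall D, D `<=` A ->
    (forall x y, D x -> D y -> x <> y -> e <= `|T x - T y|) -> countable D) ->
  exists D, [/\ D `<=` A, ~ countable D &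
    forall x y, D x -> D y -> `|T x - T y| < e + e].
Proof.
move=> e0 nA sepA.
pose sep (D : set X) := D `<=` A /\
  forall x y, D x -> D y -> x <> y -> e <= `|T x - T y|.
have [|D [[DA Dsep] Dmax]] := @Zorn_bigcup X sep.
  move=> C Csep Ctot; split=> [x [D /Csep[DA _] /DA]//|x y [D CD Dx] [E CE Ey]].
  have [DE|ED] := Ctot _ _ CD CE.
    by have [_] := Csep _ CE; apply=> //; exact: DE.
  by have [_] := Csep _ CD; apply=> //; exact: ED.
have ball_at x : A x -> exists2 d, D d & `|T x - T d| < e.
  move=> Ax; apply: contrapT => far.
  have farx d : D d -> e <= `|T x - T d|.
    move=> Dd; rewrite real_leNgt ?normr_real ?gtr0_real//.
    by apply/negP => xd; apply: far; exists d.
  have nDx : ~ D x by move=> Dx; apply: far; exists x; rewrite // subrr normr0.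
  apply: (Dmax (x |` D)).
    by split=> [d Dd|/(_ x (or_introl erefl))//]; right.
  split=> [d [->//|/DA//]|y z [->|Dy] [->|Dz] yz] //; first exact: farx.
    by rewrite distrC; exact: farx.
  exact: Dsep.
have [d Dd nd] : exists2 d, D d & ~ countable [set x | A x /\ `|T x - T d| < e].
  apply: contrapT => allc; apply: nA.
  have cU : countable (\bigcup_(d in D) [set x | A x /\ `|T x - T d| < e]).
    apply: bigcup_countable => [|d Dd]; first exact: sepA.
    by apply: contrapT => nd; apply: allc; exists d.
  apply: sub_countable cU; apply: subset_card_le => x Ax.
  by have [d Dd xd] := ball_at x Ax; exists d.
exists [set x | A x /\ `|T x - T d| < e]; split=> [x []//|//|x y [_ xd] [_ yd]].
by rewrite (le_lt_trans (ler_distD (T d) _ _))// ltrD// distrC.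
Qed.

Section condition_B_theory.
Context {K : compactHausdorffType} {F : numFieldType}.
Implicit Types (A D : set (Cspace K F)) (Y Z : normedModType F).

Definition bounded_uncountable_chain A :=
  [/\ prec_chain A, ~ countable A & has_ubound [set `|f| | f in A]].

Lemma bounded_uncountable_chain_sub {A D} : D `<=` A -> ~ countable D ->
  bounded_uncountable_chain A -> bounded_uncountable_chain D.
Proof.
move=> DA nD [Achain _ [M AM]]; split=> //.
  by move=> f g /DA Af /DA Ag; exact: Achain.
by exists M => _ [f /DA Af <-]; apply: AM; exists f.
Qed.

Lemma condition_BP {Y} {T : Cspace K F -> Y} : condition_B T <->
  forall A, bounded_uncountable_chain A -> forall e, 0 < e ->
    exists f g, [/\ A f, A g, f <> g & `|T f - T g| < e].
Proof.
split=> [BT A [Achain nA Abnd] e e0|BT A Achain nA Abnd].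
  have [_ inf0] := BT A Achain nA Abnd; apply: contrapT => noclose.
  suff /inf0 : lbound [set r | exists f g,
      [/\ A f, A g, f <> g & r = `|T f - T g|]] e by rewrite lt_geF.
  move=> _ [f [g [Af Ag fg ->]]].
  rewrite real_leNgt ?normr_real ?gtr0_real//.
  by apply/negP => lt_e; apply: noclose; exists f, g.
have A_ok : bounded_uncountable_chain A by [].
split=> [_ [f [g [_ _ _ ->]]]//|b lb].
(* The scalars are only partially ordered; a lower bound of norms is real. *)
have breal : b \is Num.real.
  have [f [g [Af Ag fg]]] := uncountable_sub_distinct nA.
  have : b <= `|T f - T g| by apply: lb; exists f, g.
  by move=> /ler_real ->; exact: normr_real.
rewrite real_leNgt ?real0//; apply/negP => b0.
have [f [g [Af Ag fg Tfg]]] := BT A A_ok b b0.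
suff : b <= `|T f - T g| by rewrite lt_geF.
by apply: lb; exists f, g.
Qed.

Lemma condition_B_cst {Y} (y : Y) : condition_B (fun _ : Cspace K F => y).
Proof.
apply/condition_BP => A [_ nA _] e e0.
have [f [g [Af Ag fg]]] := uncountable_sub_distinct nA.
by exists f, g; split; rewrite // subrr normr0.
Qed.

Lemma condition_B_dominated Y Z (T : Cspace K F -> Y) (S : Cspace K F -> Z)
    (c : F) : 0 <= c ->
  (forall f g, `|S f - S g| <= c * `|T f - T g|) ->
  condition_B T -> condition_B S.
Proof.
move=> c0 ST /condition_BP BT; apply/condition_BP => A Aok e e0.
(* [c] may vanish, hence the divisor [c + 1]. *)
have c1 : 0 < c + 1 by rewrite ltr_wpDl.
have [f [g [Af Ag fg Tfg]]] := BT A Aok _ (divr_gt0 e0 c1).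
exists f, g; split=> //; apply: (le_lt_trans (ST f g)).
apply: (@le_lt_trans _ _ ((c + 1) * `|T f - T g|)).
  by rewrite ler_wpM2r// lerDl.
by rewrite mulrC -ltr_pdivlMr.
Qed.

(** Condition (B) for [S] makes the separated subsets of a chain countable, so
    some uncountable piece of the chain has [S] almost constant on it;
    condition (B) for [T] then picks the pair inside this piece. *)
Lemma condition_B_add Y (S T : Cspace K F -> Y) :
  condition_B S -> condition_B T -> condition_B (fun f => S f + T f).
Proof.
move=> /condition_BP BS /condition_BP BT; apply/condition_BP => A Aok e e0.
have d0 : 0 < e / 2 / 2 by rewrite !divr_gt0.
have [|D DA Dsep|D [DA nD Dsmall]] :=
    @uncountable_small_subset F Y _ S A (e / 2 / 2) d0.
- by case: Aok.
- apply: contrapT => nD.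
  have [f [g [Df Dg fg Sfg]]] :=
    BS D (bounded_uncountable_chain_sub DA nD Aok) _ d0.
  by have := Dsep f g Df Dg fg; rewrite lt_geF.
have e2 : 0 < e / 2 by rewrite divr_gt0.
have [f [g [Df Dg fg Tfg]]] :=
  BT D (bounded_uncountable_chain_sub DA nD Aok) _ e2.
exists f, g; split=> //; [exact: DA|exact: DA|].
have := Dsmall f g Df Dg; rewrite -splitr => Sfg.
rewrite opprD addrACA (le_lt_trans (ler_normD _ _))//.
by rewrite [e]splitr ltrD.
Qed.

(** The approximation is uniform on balls only, as for operators close in norm;
    it applies because the chains in condition (B) are bounded. *)
Lemma condition_B_limit Y (T : Cspace K F -> Y) :
  (forall M e : F, 0 <= M -> 0 < e -> exists2 S : Cspace K F -> Y,
    condition_B S & forall f, `|f| <= M -> `|T f - S f| < e) ->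
  condition_B T.
Proof.
move=> Tapprox; apply/condition_BP => A Aok e e0.
have [_ nA [M AM]] := Aok.
have AMle f : A f -> `|f| <= M by move=> Af; apply: AM; exists f.
have M0 : 0 <= M.
  have [f [_ [Af _ _]]] := uncountable_sub_distinct nA.
  exact: le_trans (normr_ge0 f) (AMle f Af).
have e2 : 0 < e / 2 by rewrite divr_gt0.
have e4 : 0 < e / 2 / 2 by rewrite divr_gt0.
have [S /condition_BP BS TS] := Tapprox M _ M0 e4.
have [f [g [Af Ag fg Sfg]]] := BS A Aok _ e2.
exists f, g; split=> //.
have Tf := TS f (AMle f Af); have := TS g (AMle g Ag); rewrite distrC => Tg.
have -> : e = e / 2 / 2 + (e / 2 + e / 2 / 2) by rewrite addrCA -!splitr.
rewrite (le_lt_trans (ler_distD (S f) _ _))// ltrD//.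
by rewrite (le_lt_trans (ler_distD (S g) _ _))// ltrD.
Qed.

End condition_B_theory.

Lemma op_norm_le {F : scalarFieldType} {E : normedModType F}
    (T : bounded_op E) (u : E) : `|T u| <= `|T| * `|u|.
Proof. by have [_ [Tle _]] := op_normP T; exact: Tle. Qed.

Lemma op_closure_approx {F : scalarFieldType} {E : normedModType F}
    {I : set (bounded_op E)} {T : bounded_op E} {M e : F} :
  closure I T -> 0 <= M -> 0 < e ->
  exists2 S, I S & forall u, `|u| <= M -> `|T u - S u| < e.
Proof.
move=> clT M0 e0.
have M1 : 0 < M + 1 by rewrite ltr_wpDl.
have [S [IS]] := clT _ (nbhsx_ballx T _ (divr_gt0 e0 M1)).
rewrite -ball_normE /ball_ /= => TS; exists S => // u uM.
rewrite -opBE (le_lt_trans (op_norm_le _ _))//.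
apply: (@le_lt_trans _ _ (`|T - S| * (M + 1))); last by rewrite -ltr_pdivlMr.
by rewrite ler_wpM2l// (le_trans uM)// lerDl.
Qed.

Lemma condition_B_closed_left_ideal (F : scalarFieldType)
    (K : compactHausdorffType) :
  closed_left_ideal [set T : bounded_op (Cspace K F) | condition_B T].
Proof.
split; last split.
- move=> T clT /=; apply: condition_B_limit => M e M0 e0.
  have [S BS TS] := op_closure_approx clT M0 e0.
  by exists S.
- exact: condition_B_cst.
- by move=> S T BS BT; exact: condition_B_add BS BT.
- move=> a T; apply: (@condition_B_dominated _ _ _ _ _ _ `|a|) => // f g.
  by rewrite !opZE -scalerBr normrZ.
- move=> S T; apply: (@condition_B_dominated _ _ _ _ _ _ `|S|) => // f g.
  by rewrite !opME -linearB; exact: op_norm_le.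
Qed.

Theorem theorem4p2 (R : realType) (K : compactHausdorffType) :
  closed_left_ideal [set T : bounded_op (Cspace K R) | condition_B T] /\
  closed_left_ideal [set T : bounded_op (Cspace K R[i]) | condition_B T].
Proof.
split; [exact: (@condition_B_closed_left_ideal R K)
       |exact: (@condition_B_closed_left_ideal R[i] K)].
Qed.
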